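(* Let $1\le k<n$ be integers, $a\in(0,n]$ and $s>0$ real. Then there exist constants $c>0$ and $p_0$, depending only on $n,k,a,s$, such that for every prime $p\ge p_0$ there exists $A\subset\mathbb{F}_p^n$ with $\#A\ge c\,p^a$ and $$\#E_s(A;n,k)\ge c\,p^{\mathbf{M}(a,s;n,k)}.$$
   Context: $\mathbb{F}_p$ is the field with $p$ elements, $p$ prime. $G(m,\mathbb{F}_p^n)$ is the set of $m$-dimensional linear subspaces of $\mathbb{F}_p^n$. For $V\in G(m,\mathbb{F}_p^n)$ let $\pi_V^*(x)=x+V$ (a map from $\mathbb{F}_p^n$ to the set of translates of $V$), and $\pi_V^*(A)=\{x+V:x\in A\}$. For $A\subset\mathbb{F}_p^n$, $$E_s(A;n,k)=\{V\in G(n-k,\mathbb{F}_p^n):\#\pi_V^*(A)<p^s\}.$$ Marstrand index $\mathbf{M}(a,s;n,k)$ (integers $1\le k<n$, $a\in(0,n]$, $s>0$): write $a=m+\beta$, $s=l+\gamma$ with nonnegative integers $m,l$ and $\beta,\gamma\in(0,1]$ (unique). Then Type 1: if $s>\min\{a,k\}$, $\mathbf{M}(a,s;n,k)=k(n-k)$. Type 2: if $s\le\min\{a,k\}$, $l+1\le m\le n+l-k$ and $\gamma\in(\beta,1]$, $\mathbf{M}(a,s;n,k)=k(n-k)-(m-l)(k-l)+\max\{2\gamma-(\beta+1),0\}$. Type 3: if $s\le\min\{a,k\}$, $l\le m\le n+l-k-1$ and $\gamma\in(0,\beta]$, $\mathbf{M}(a,s;n,k)=k(n-k)-(m+1-l)(k-l)+\max\{2\gamma-\beta,0\}$.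 Type 4: if $s\le a-(n-k)$, $\mathbf{M}(a,s;n,k)=-\infty$. These types cover every $(a,s)$ exactly once. Convention: $p^{-\infty}=0$. *)

(* Defs.v *)
From HB Require Import structures.
From mathcomp Require Import all_boot all_order all_algebra.
From mathcomp Require Import zify ring lra.
From mathcomp Require Import reals constructive_ereal exp.

Set Implicit Arguments.
Unset Strict Implicit.
Unset Printing Implicit Defensive.

Import Order.TTheory GRing.Theory Num.Theory VectorInternalTheory.

Local Open Scope ring_scope.

HB.instance Definition _ (F : finFieldType) (vT : vectType F) :=
  [Countable of {vspace vT} by <:].
HB.instance Definition _ (F : finFieldType) (vT : vectType F) :=
  [Finite of {vspace vT} by <:].

Section Projections.

Variables (p n : nat).
Implicit Types (V : {vspace 'rV['F_p]_n}) (A : {set 'rV['F_p]_n}).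

Definition grassmannian (m : nat) : {set {vspace 'rV['F_p]_n}} :=
  [set V | \dim V == m].

Definition dual_proj V (x : 'rV['F_p]_n) : {set 'rV['F_p]_n} :=
  [set x + v | v in V].

Definition exceptional_set (R : realType) A (s : R) (k : nat) :
    {set {vspace 'rV['F_p]_n}} :=
  [set V in grassmannian (n - k) | #|dual_proj V @: A|%:R < p%:R `^ s].

End Projections.

Section MarstrandIndex.

Variable R : realType.
Implicit Types (a s x : R) (n k : nat).

(* x = ipart x + fpart x with fpart x in ]0, 1]: the half-open interval
   excludes 0, so that ipart is the ceiling minus one and not the floor. *)
Definition ipart x : int := Num.ceil x - 1.
Definition fpart x : R := x - (ipart x)%:~R.

Lemma fpart_itv x : 0 < fpart x <= 1.
Proof.
have /andP[] := real_ceil_itv (num_real x); rewrite /fpart /ipart.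
by rewrite intrB => h1 h2; apply/andP; split; lra.
Qed.

Lemma ipart_ge0 x : 0 < x -> 0 <= ipart x.
Proof. by move=> x0; rewrite /ipart subr_ge0 -gtz0_ge1 ceil_gt0. Qed.

Lemma ipart_unique (m : int) (b x : R) :
  0 < b <= 1 -> x = m%:~R + b -> ipart x = m /\ fpart x = b.
Proof.
move=> /andP[b0 b1] xE.
suff mE : ipart x = m by split; rewrite // /fpart mE xE addrC addKr.
rewrite /ipart; have -> : Num.ceil x = m + 1; last by rewrite addrK.
apply: ceil_def; rewrite addrK intrD xE; lra.
Qed.

Lemma le_ipart x y : (x <= y) =
  (ipart x < ipart y) || (ipart x == ipart y) && (fpart x <= fpart y).
Proof.
have /andP[b0 b1] := fpart_itv x; have /andP[c0 c1] := fpart_itv y.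
have xE : x = (ipart x)%:~R + fpart x by rewrite /fpart addrC subrK.
have yE : y = (ipart y)%:~R + fpart y by rewrite /fpart addrC subrK.
rewrite {1}xE {1}yE; case: (ltrgtP (ipart x) (ipart y)) => [h|h|->] /=.
- have : (ipart x)%:~R + 1 <= (ipart y)%:~R :> R.
    by rewrite -[1]/(1%:~R) -intrD ler_int; lia.
  by move=> h1; apply/idP; lra.
- have : (ipart y)%:~R + 1 <= (ipart x)%:~R :> R.
    by rewrite -[1]/(1%:~R) -intrD ler_int; lia.
  by move=> h1; apply/negbTE; rewrite -ltNge; lra.
- by rewrite lerD2l.
Qed.

Definition marstrand_type1 a s k : bool := Num.min a k%:R < s.

Definition marstrand_type2 a s n k : bool :=
  [&& s <= Num.min a k%:R, ipart s + 1 <= ipart a,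
      ipart a <= n%:Z + ipart s - k%:Z & fpart a < fpart s].

Definition marstrand_type3 a s n k : bool :=
  [&& s <= Num.min a k%:R, ipart s <= ipart a,
      ipart a <= n%:Z + ipart s - k%:Z - 1 & fpart s <= fpart a].

Definition marstrand_type4 a s n k : bool := s <= a - (n%:R - k%:R).

(* The last branch is type 4, see marstrand_type4E. *)
Definition marstrand_index a s n k : \bar R :=
  let m : R := (ipart a)%:~R in let b := fpart a in
  let l : R := (ipart s)%:~R in let c := fpart s in
  let N : R := n%:R in let K : R := k%:R in
  if marstrand_type1 a s k then (K * (N - K))%:E
  else if marstrand_type2 a s n k then
    (K * (N - K) - (m - l) * (K - l) + Num.max (2 * c - (b + 1)) 0)%:E
  else if marstrand_type3 a s n k then
    (K * (N - K) - (m + 1 - l) * (K - l) + Num.max (2 * c - b) 0)%:E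
  else -oo%E.

Lemma marstrand_type23F a s n k :
  ~~ (marstrand_type2 a s n k && marstrand_type3 a s n k).
Proof.
by apply/negP => /andP[/and4P[_ _ _ h1] /and4P[_ _ _ h2]]; lra.
Qed.

Lemma marstrand_type4E a s n k : (k < n)%N -> a <= n%:R ->
  marstrand_type4 a s n k =
  ~~ [|| marstrand_type1 a s k, marstrand_type2 a s n k
       | marstrand_type3 a s n k].
Proof.
move=> kn an; rewrite /marstrand_type1 /marstrand_type2 /marstrand_type3.
rewrite /marstrand_type4 ltNge le_min.
have ua := fpart_itv a; have us := fpart_itv s.
have aE : a = (ipart a)%:~R + fpart a by rewrite /fpart addrC subrK.
have natE q : ipart q%:R = q%:Z - 1 /\ fpart q%:R = 1 :> R.
  by apply: ipart_unique; [rewrite ltr01 lexx | rewrite intrB subrK].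
have [i1 f1] : ipart (a - (n%:R - k%:R)) = ipart a - (n%:Z - k%:Z)
               /\ fpart (a - (n%:R - k%:R)) = fpart a.
  apply: ipart_unique => //; move: aE.
  by move: (fpart a) (ipart a) => f i ->; rewrite !intrB addrAC.
move: an; rewrite [s <= a]le_ipart [a <= _]le_ipart [s <= k%:R]le_ipart.
rewrite [s <= a - _]le_ipart.
rewrite i1 f1.
have [-> ->] := natE n; have [-> ->] := natE k.
have [_ a1] := andP ua; have [_ s1] := andP us.
rewrite a1 s1 [fpart a < _]ltNge; case: (fpart s <= fpart a) => /=;
  rewrite ?andbT ?andbF /=; lia.
Qed.

End MarstrandIndex.

(* The power x ^ e for an extended real exponent and a base x > 1. *)
Definition epowR (R : realType) (x : R) (e : \bar R) : \bar R :=
  match e with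
  | r%:E => (x `^ r)%:E
  | +oo => +oo
  | -oo => 0
  end%E.

(* Main.v *)
Require Import Defs.
From mathcomp Require Import all_boot all_order all_algebra.
From mathcomp Require Import zify ring lra.
From mathcomp Require Import reals constructive_ereal exp.

Import Order.TTheory GRing.Theory Num.Theory.

Local Open Scope ring_scope.

(** Write n = q + k. A q x k matrix B gives the q-dimensional subspace
    V_B = {(u, - u B)} of F_p^q x F_p^k, and x = (u, w) has the same class
    modulo V_B as (0, u B + w). These subspaces are pairwise distinct
    (graph_inj), so it suffices to count matrices B for which the set of all
    u B + w, for (u, w) in A, is small.

    If s > min(a, k), any A with at most p^a points works, and all
    p^(qk) matrices B are allowed (trivial_example).

    If the index is -oo, A can be the whole space. In the two remaining types
    write s = l + g with 0 < g <= 1, and a = r + l + b with g <= b <= 1 + g.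
    Let A be the product of F_p^r x [0,N2) x 0 in F_p^q and F_p^l x [0,N1) x 0
    in F_p^k, with N1 ~ p^g and N2 ~ p^(b-g), so that A has about p^a points.
    Take B of the form

                        l columns    1 column    k-l-1 columns
              r rows        *            0              0
              1 row         *            d              0
          q-r-1 rows        *            *              *

    with 0 <= d < D. On A the last q-r-1 coordinates of u vanish, so u B + w
    is arbitrary in its first l coordinates, has the form x + d y with x < N1
    and y < N2 in the next one, and is 0 in the others. It takes at most about
    p^l (N1 + D N2) values, which is below p^(l+g) as soon as D N2 is a small
    multiple of p^g: D ~ p^max(2g-b,0) is allowed. The number of such B is
    p^(l(r+1) + k(q-r-1)) D, and l(r+1) + k(q-r-1) = kq - (r+1)(k-l).

    With a = m + beta and g = gamma, both types are instances of this single
    construction (grid_example): b = beta and r = m - l if gamma <= beta, and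
    b = beta + 1 and r = m - l - 1 if gamma > beta; the interval
    conditions on m say exactly that 0 <= r < q. *)

(** * Boxes and their cardinality *)

Definition stair {T : Type} (r : nat) (x y z : T) (i : nat) : T :=
  if (i < r)%N then x else if i == r then y else z.

Lemma card_stair (T : finType) (r : nat) (X Y Z : {set T}) (i : nat) :
  #|stair r X Y Z i| = stair r #|X| #|Y| #|Z| i.
Proof. by rewrite /stair; case: ifP => //; case: ifP. Qed.

Lemma prod_stair (n r x y z : nat) : (r < n)%N ->
  (\prod_(i < n) stair r x y z i = x ^ r * y * z ^ (n - r.+1))%N.
Proof.
move=> /subnKC; move: (n - r.+1)%N => t <-; rewrite big_split_ord big_ord_recr /=.
rewrite [stair _ _ _ _ r]/stair ltnn eqxx.
congr (_ * _ * _)%N.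
- under eq_bigr => i _ do rewrite /stair ltn_ord.
  by rewrite prod_nat_const card_ord.
- under eq_bigr => i _ do rewrite /stair ltnNge (gtn_eqF (leq_addr _ _))
    (leq_trans (leqnSn r) (leq_addr _ _)).
  by rewrite prod_nat_const card_ord.
Qed.

(** The index sets of S are nat rather than ordinals so that the same profile,
    such as a stair, serves in every dimension. *)
Definition mxbox {F : finType} {m n : nat} (S : nat -> nat -> {set F}) :
    {set 'M[F]_(m, n)} :=
  [set M : 'M[F]_(m, n) | [forall i, forall j, M i j \in S i j]].

Lemma mxboxP {F : finType} {m n : nat} {S : nat -> nat -> {set F}}
    {M : 'M[F]_(m, n)} :
  reflect (forall i j, M i j \in S i j) (M \in mxbox S).
Proof. by rewrite inE; apply: 'forall_forallP. Qed.

Lemma card_mxbox (F : finType) (m n : nat) (S : nat -> nat -> {set F}) :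
  #|mxbox S : {set 'M[F]_(m, n)}| = (\prod_(i < m) \prod_(j < n) #|S i j|)%N.
Proof.
pose C (x : 'I_m * 'I_n) : pred F := mem (S x.1 x.2).
pose ofC (f : {ffun 'I_m * 'I_n -> F}) : 'M[F]_(m, n) := \matrix_(i, j) f (i, j).
have -> : mxbox S = [set ofC f | f in family C].
  apply/setP => M; apply/mxboxP/imsetP => [MS|[f /familyP fC ->] i j].
    exists [ffun x => M x.1 x.2]; last by apply/matrixP => i j; rewrite mxE ffunE.
    by apply/familyP => x; rewrite ffunE; apply: MS.
  by rewrite mxE; apply: (fC (i, j)).
rewrite card_imset; last first.
  by move=> f g /matrixP fg; apply/ffunP => -[i j]; have := fg i j; rewrite !mxE.
by rewrite card_family foldrE big_map big_enum pair_big.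
Qed.

(** * Initial segments of the prime field *)

Definition Fp_initial (p N : nat) : {set 'F_p} := [set i%:R | i : 'I_N].

Lemma natr_Fp_initial (p N i : nat) : (i < N)%N -> i%:R \in Fp_initial p N.
Proof. by move=> iN; apply/imsetP; exists (Ordinal iN). Qed.

Lemma Fp_initialP (p N : nat) (x : 'F_p) :
  reflect (exists2 i, (i < N)%N & x = i%:R) (x \in Fp_initial p N).
Proof.
apply: (iffP imsetP) => [[i _ ->]|[i iN ->]]; first by exists i.
by exists (Ordinal iN).
Qed.

Lemma card_Fp_initial (p N : nat) : prime p -> (N <= p)%N ->
  #|Fp_initial p N| = N.
Proof.
move=> pr_p Np; rewrite card_imset ?card_ord // => i j /(congr1 (@nat_of_ord _)).
rewrite !val_Fp_nat // !modn_small ?(leq_trans (ltn_ord _)) //.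
exact: val_inj.
Qed.

(** * Subspaces that are graphs of matrices *)

Section Graph.
Context {F : fieldType} {q k : nat}.
Implicit Types B : 'M[F]_(q, k).

(** A linear map with kernel [graph B]; it identifies the quotient by
    [graph B] with F^k. *)
Definition graph_proj B : 'Hom('rV[F]_(q + k), 'rV[F]_k) :=
  linfun (mulmxr (col_mx B 1%:M)).

Definition graph B : {vspace 'rV[F]_(q + k)} := lker (graph_proj B).

Lemma graph_projE B (u : 'rV_q) (w : 'rV_k) : graph_proj B (row_mx u w) = u *m B + w.
Proof. by rewrite lfunE /= mul_row_col mulmx1. Qed.

Lemma mem_graph B (u : 'rV_q) (w : 'rV_k) :
  (row_mx u w \in graph B) = (w == - (u *m B)).
Proof. by rewrite memv_ker graph_projE addrC addr_eq0. Qed.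

(** Rank-nullity: [graph_proj B] is onto, already on the vectors (0, w). *)
Lemma dim_graph B : \dim (graph B) = q.
Proof.
have := limg_ker_dim (graph_proj B) fullv; rewrite capfv.
have -> : limg (graph_proj B) = fullv.
  apply/vspaceP => w; rewrite memvf; apply/memv_imgP; exists (row_mx 0 w).
    exact: memvf.
  by rewrite graph_projE mul0mx add0r.
by rewrite !dimvf /= !dim_matrix !mul1r => /addIn.
Qed.

(** The i-th row of B is read off from the only vector of [graph B] whose first
    component is the i-th basis vector. *)
Lemma graph_inj : injective graph.
Proof.
move=> B C BC; apply/row_matrixP => i; rewrite !rowE.
have : row_mx (delta_mx 0 i) (- (delta_mx 0 i *m B)) \in graph C.
  by rewrite -BC mem_graph.
by rewrite mem_graph => /eqP/oppr_inj.
Qed.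
End Graph.

Lemma dual_proj_graph (p q k : nat) (B : 'M['F_p]_(q, k)) (u : 'rV_q) (w : 'rV_k) :
  dual_proj (graph B) (row_mx u w) = dual_proj (graph B) (row_mx 0 (u *m B + w)).
Proof.
have dE x y : x - y \in graph B -> dual_proj (graph B) x \subset dual_proj (graph B) y.
  move=> xy; apply/subsetP => _ /imsetP[v vB ->]; apply/imsetP; exists (x - y + v).
    by rewrite memvD.
  by rewrite addrA subrKC.
have uw : row_mx u w - row_mx 0 (u *m B + w) \in graph B.
  by rewrite opp_row_mx add_row_mx subr0 mem_graph opprD addrCA subrr addr0.
by apply/eqP; rewrite eqEsubset !dE // -opprB memvN.
Qed.

(** Every translate of [graph B] meets {0} x F^k, so the translates of the
    points of A are labelled by the values u B + w. *)
Lemma card_dual_proj_graph {p q k : nat} {B : 'M['F_p]_(q, k)}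
    {A : {set 'rV['F_p]_(q + k)}} {T : {set 'rV['F_p]_k}} :
  {in A, forall x, lsubmx x *m B + rsubmx x \in T} ->
  (#|dual_proj (graph B) @: A| <= #|T|)%N.
Proof.
move=> AT; pose transl z := dual_proj (graph B) (row_mx 0 z).
apply: leq_trans (leq_imset_card transl _).
apply/subset_leq_card/subsetP => _ /imsetP[x xA ->]; apply/imsetP.
exists (lsubmx x *m B + rsubmx x); first exact: AT.
by rewrite -{1}[x]hsubmxK dual_proj_graph.
Qed.

(** Restricting to graphs loses only a constant factor in the Grassmannian, and
    turns the counting of subspaces into the counting of matrices. *)
Lemma exceptional_graphs (R : realType) (p q k : nat)
    (A : {set 'rV['F_p]_(q + k)}) (Bs : {set 'M['F_p]_(q, k)}) (s : R) :
  {in Bs, forall B, #|dual_proj (graph B) @: A|%:R < p%:R `^ s} ->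
  (#|Bs| <= #|exceptional_set A s k|)%N.
Proof.
move=> small; rewrite -(card_imset _ graph_inj).
apply/subset_leq_card/subsetP => _ /imsetP[B BsB ->].
by rewrite !inE dim_graph addnK eqxx small.
Qed.

(** * The product set and its family of matrices *)

Section Example.
Context {p : nat} (p_prime : prime p).

(** The coordinates of F_p^r x [0,N) x 0. *)
Definition slab (r N : nat) : nat -> {set 'F_p} :=
  stair r [set: 'F_p] (Fp_initial p N) [set 0].

(** The block pattern of the matrices B: [slab l 1] is F_p^l x 0, because
    [0,1) = {0}, and [slab l D] leaves D choices for the entry d. *)
Definition slab_rows (l r D : nat) : nat -> nat -> {set 'F_p} :=
  stair r (slab l 1) (slab l D) (fun=> [set: 'F_p]).

Lemma prod_card_slab (n r N : nat) : (r < n)%N -> (N <= p)%N ->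
  (\prod_(i < n) #|slab r N i| = p ^ r * N)%N.
Proof.
move=> rn Np; under eq_bigr => i _ do rewrite card_stair.
by rewrite prod_stair // cardsT card_Fp // card_Fp_initial // cards1 exp1n muln1.
Qed.

Definition product_set (q k r l N1 N2 : nat) : {set 'rV['F_p]_(q + k)} :=
  [set row_mx x.1 x.2 | x in setX (mxbox (fun=> slab r N2) : {set 'rV['F_p]_q})
                                  (mxbox (fun=> slab l N1) : {set 'rV['F_p]_k})].

Lemma card_product_set (q k r l N1 N2 : nat) :
  (r < q)%N -> (l < k)%N -> (N1 <= p)%N -> (N2 <= p)%N ->
  #|product_set q k r l N1 N2| = (p ^ (r + l) * (N1 * N2))%N.
Proof.
move=> rq lk N1p N2p; rewrite card_imset; last first.
  by move=> [u w] [u' w'] /eq_row_mx /= [-> ->].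
by rewrite cardsX !card_mxbox !big_ord1 !prod_card_slab // expnD; ring.
Qed.

Lemma card_slab_rows (q k r l D : nat) :
  (r < q)%N -> (l < k)%N -> (D <= p)%N ->
  #|mxbox (slab_rows l r D) : {set 'M['F_p]_(q, k)}|
    = (p ^ (l * r.+1 + k * (q - r.+1)) * D)%N.
Proof.
move=> rq lk Dp; rewrite card_mxbox.
have -> : (\prod_(i < q) \prod_(j < k) #|slab_rows l r D i j|
    = \prod_(i < q) stair r (p ^ l) (p ^ l * D) (p ^ k) i)%N.
  apply: eq_bigr => i _; rewrite /slab_rows /stair.
  case: ifP => _; first by rewrite prod_card_slab ?prime_gt0 // muln1.
  case: ifP => _; first by rewrite prod_card_slab.
  by rewrite prod_nat_const card_ord cardsT card_Fp.
by rewrite prod_stair // expnD mulnS expnD !expnM; ring.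
Qed.

(** Only the distinguished row r can contribute to a column j >= l: the rows of
    B above it vanish there, and the rows below it meet zero coordinates of u.
    In column l what remains is x + d y with x < N1, y < N2 and d < D. *)
Lemma product_set_proj {q k r l N1 N2 D : nat} {B : 'M['F_p]_(q, k)} :
  (r < q)%N -> (0 < N1)%N ->
  B \in mxbox (slab_rows l r D) ->
  {in product_set q k r l N1 N2, forall x,
    lsubmx x *m B + rsubmx x \in mxbox (fun=> slab l (N1.-1 + D.-1 * N2.-1).+1)}.
Proof.
move=> rq N1_gt0 /mxboxP Bbox x /imsetP[[u w]].
rewrite in_setX /= => /andP[/mxboxP ubox /mxboxP wbox] ->.
rewrite row_mxKl row_mxKr; apply/mxboxP => i j.
rewrite {i}ord1 !mxE.
have [jl|lj] := ltnP j l; first by rewrite /slab /stair jl inE.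
have slabE N : slab l N j = if j == l :> nat then Fp_initial p N else [set 0].
  by rewrite /slab /stair ltnNge lj.
pose i0 := Ordinal rq.
rewrite (bigD1 i0) //= big1 => [|i /negPf i_i0]; last first.
  case: (ltnP i r) => [ir|ri].
    have := Bbox i j; rewrite /slab_rows {1}/stair ir slabE.
    case: eqP => _; last by move/set1P->; rewrite mulr0.
    by case/Fp_initialP=> d; rewrite ltnS leqn0 => /eqP-> ->; rewrite mulr0.
  have := ubox 0 i; rewrite /slab /stair ltnNge ri /=.
  have -> : (i == r :> nat) = false by rewrite -i_i0.
  by move/set1P->; rewrite mul0r.
rewrite addr0.
have := Bbox i0 j; have := ubox 0 i0; have := wbox 0 j.
rewrite /slab_rows {2}/slab /stair /= ltnn eqxx !slabE; case: eqP => _; last first.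
  by move=> /set1P-> _ /set1P->; rewrite mulr0 addr0 set11.
move=> /Fp_initialP[x1 x1N ->] /Fp_initialP[x2 x2N ->] /Fp_initialP[d dD ->].
rewrite -natrM -natrD natr_Fp_initial // ltnS addnC leq_add ?leq_pred //.
  by rewrite -ltnS prednK.
by rewrite mulnC leq_mul // -ltnS prednK ?(leq_trans _ dD) ?(leq_trans _ x2N).
Qed.
End Example.

(** * Real exponents *)

Section Rounding.
Context {R : realType}.
Implicit Types x : R.

(** The truncation of x / 3 may be 0; its successor is a nonempty size for which
    the lower bound x / 3 survives, and the upper bounds below only involve the
    predecessor. *)
Definition round_third x : nat := (Num.truncn (x / 3)).+1.

Lemma round_third_gt x : x / 3 < (round_third x)%:R.
Proof. exact: truncnS_gt. Qed.

Lemma round_third_pred_le x : 0 <= x -> (round_third x).-1%:R <= x / 3.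
Proof. by move=> x0; rewrite truncn_le divr_ge0. Qed.

Lemma round_third_le x (p : nat) : (1 < p)%N -> 0 <= x -> x <= p%:R ->
  (round_third x <= p)%N.
Proof.
move=> p1 x0 xp; rewrite /round_third truncn_lt_nat ?divr_ge0 //.
have : 1 < p%:R :> R by rewrite ltr1n.
lra.
Qed.
End Rounding.

Lemma ltr_powR {R : realType} {x u v : R} : 1 < x -> u < v -> x `^ u < x `^ v.
Proof.
move=> x1 uv; have x0 : 0 < x by apply: lt_trans x1.
rewrite -[v](subrK u) powRD ?(lt0r_neq0 x0) ?implybT //.
rewrite ltr_pMl ?powR_gt0 //; have -> : 1 = 1 `^ (v - u) by rewrite powR1.
by rewrite gt0_ltr_powR ?subr_gt0 ?nnegrE // ltW.
Qed.

Lemma powR_unbounded (R : realType) (g C : R) : 0 < g ->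
  exists p0 : nat, forall p : nat, (p0 <= p)%N -> C < p%:R `^ g.
Proof.
move=> g0; exists (Num.truncn (Num.max C 0 `^ g^-1)).+1 => p p0p.
have Cp : Num.max C 0 `^ g^-1 < p%:R.
  by apply: lt_le_trans (truncnS_gt _) _; rewrite ler_nat.
have C0 : 0 <= Num.max C 0 by rewrite le_max lexx orbT.
apply: (@le_lt_trans _ _ (Num.max C 0)); first by rewrite le_max lexx.
have -> : Num.max C 0 = (Num.max C 0 `^ g^-1) `^ g.
  by rewrite -powRrM mulVf ?powRr1 // lt0r_neq0.
by rewrite gt0_ltr_powR ?nnegrE ?powR_ge0.
Qed.

(** N1, N2 and D are a third of p^g, p^(b-g) and p^max(2g-b,0), rounded: then
    N1-1 + (D-1)(N2-1) + 1 <= p^g/3 + p^g/9 + 1, which is below p^g once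
    p^g > 3, and both lower bounds lose at most a factor 9. The bounds
    g <= 1, b <= 1 + g make N1, N2, D at most p, so that the segments of F_p
    really have these sizes. *)
Lemma grid_example (R : realType) (q k r l : nat) (b g : R) :
  (r < q)%N -> (l < k)%N -> 0 < g <= 1 -> g <= b <= 1 + g ->
  exists p0 : nat, forall p : nat, prime p -> (p0 <= p)%N ->
    exists A : {set 'rV['F_p]_(q + k)},
      9^-1 * p%:R `^ ((r + l)%:R + b) <= #|A|%:R /\
      9^-1 * p%:R `^ ((l * r.+1 + k * (q - r.+1))%:R + Num.max (2 * g - b) 0)
        <= #|exceptional_set A (l%:R + g) k|%:R.
Proof.
move=> rq lk /andP[g0 g1] /andP[gb bg].
have [p0 p0P] := @powR_unbounded R g 3 g0.
exists p0 => p p_prime /p0P p_big.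
have p1 := prime_gt1 p_prime.
have P1 : 1 <= p%:R :> R by rewrite ler1n ltnW.
have P0 : 0 < p%:R :> R by apply: lt_le_trans P1.
have powD (x y : R) : p%:R `^ (x + y) = p%:R `^ x * p%:R `^ y.
  by rewrite powRD // (lt0r_neq0 P0) implybT.
have powN (m : nat) : p%:R `^ m%:R = (p ^ m)%:R :> R by rewrite powR_mulrn ?natrX // ltW.
have powle (x : R) : x <= 1 -> p%:R `^ x <= p%:R.
  by move=> x1; rewrite -[leRHS]powRr1 ?ler_powR // ltW.
pose e : R := Num.max (2 * g - b) 0.
have e1 : e <= 1 by rewrite ge_max ler01 andbT; lra.
have bg1 : b - g <= 1 by lra.
pose N1 := round_third (p%:R `^ g); pose N2 := round_third (p%:R `^ (b - g)).
pose D := round_third (p%:R `^ e).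
have N1p : (N1 <= p)%N by rewrite round_third_le ?powR_ge0 ?powle.
have N2p : (N2 <= p)%N by rewrite round_third_le ?powR_ge0 ?powle.
have Dp : (D <= p)%N by rewrite round_third_le ?powR_ge0 ?powle.
(* If 2 g <= b then D = 1; otherwise the exponents of D and N2 add up to g. *)
have DN2 : D.-1%:R * N2.-1%:R <= p%:R `^ g / 9.
  rewrite /D /e; case: (leP (2 * g - b) 0) => eP.
    have -> : (round_third (p%:R `^ 0 : R)).-1 = 0%N.
      by rewrite powRr0 /=; apply/truncn0Pn; rewrite -ltNge; lra.
    by rewrite mul0r divr_ge0 ?powR_ge0.
  have -> : p%:R `^ g / 9 = (p%:R `^ (2 * g - b) / 3) * (p%:R `^ (b - g) / 3).
    by rewrite mulrACA -powD; congr (_ `^ _ * _); [ring|field].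
  by rewrite ler_pM ?ler0n ?round_third_pred_le ?powR_ge0.
exists (product_set q k r l N1 N2); split.
  rewrite card_product_set // powD powN natrM mulrCA.
  rewrite ler_pM2l ?ltr0n ?expn_gt0 ?prime_gt0 //.
  rewrite natrM -[b](subrKC g) powD.
  have := round_third_gt (p%:R `^ g); have := round_third_gt (p%:R `^ (b - g)).
  rewrite -/N1 -/N2 => /ltW h2 /ltW h1.
  have -> (x y : R) : 9^-1 * (x * y) = (x / 3) * (y / 3) by field.
  by rewrite ler_pM ?divr_ge0 ?powR_ge0.
pose Bs : {set 'M['F_p]_(q, k)} := mxbox (slab_rows l r D).
have small : {in Bs, forall B, #|dual_proj (graph B) @: product_set q k r l N1 N2|%:R
     < p%:R `^ (l%:R + g)}.
  move=> B BsB.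
  pose T : {set 'rV['F_p]_k} := mxbox (fun=> slab l (N1.-1 + D.-1 * N2.-1).+1).
  apply: (@le_lt_trans _ _ #|T|%:R).
    by rewrite ler_nat card_dual_proj_graph //; apply: product_set_proj.
  have N3_lt : ((N1.-1 + D.-1 * N2.-1).+1)%:R < p%:R `^ g :> R.
    have := @round_third_pred_le R (p%:R `^ g) (powR_ge0 _ _).
    rewrite -/N1 -[(_ + _).+1%:R]natr1 natrD natrM; lra.
  have N3p : ((N1.-1 + D.-1 * N2.-1).+1 <= p)%N.
    by rewrite -(ler_nat R) (le_trans (ltW N3_lt)) ?powle.
  rewrite /T card_mxbox big_ord1 prod_card_slab // natrM powD powN.
  by rewrite ltr_pM2l // ltr0n expn_gt0 prime_gt0.
apply: (@le_trans _ _ #|Bs|%:R); last by rewrite ler_nat exceptional_graphs.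
rewrite card_slab_rows // powD powN natrM mulrCA ler_pM2l ?ltr0n ?expn_gt0 ?prime_gt0 //.
have := round_third_gt (p%:R `^ e); have := @powR_ge0 R p%:R e.
rewrite -/D; lra.
Qed.

(** There are at most #|A| and at most p^k translates, so a set of at most p^a
    points is small in every direction when min(a, k) < s. *)
Lemma trivial_example {R : realType} {q k p : nat} {a s : R} :
  prime p -> 0 < a -> a <= (q + k)%:R -> Num.min a k%:R < s ->
  exists A : {set 'rV['F_p]_(q + k)},
    2^-1 * p%:R `^ a <= #|A|%:R /\ (p ^ (q * k) <= #|exceptional_set A s k|)%N.
Proof.
move=> p_prime a0 an; rewrite gt_min => as_ks.
have P1 : 1 < p%:R :> R by rewrite ltr1n prime_gt1.
have powN (m : nat) : p%:R `^ m%:R = (p ^ m)%:R :> R by rewrite powR_mulrn ?natrX.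
set N := Num.truncn (p%:R `^ a : R).
have pa1 : 1 <= p%:R `^ a :> R.
  by rewrite -[leLHS](powRr0 p%:R) ler_powR // ltW.
have Na : N%:R <= p%:R `^ a :> R by rewrite truncn_le powR_ge0.
have aN : p%:R `^ a < N.+1%:R :> R by apply: truncnS_gt.
have N0 : (0 < N)%N by rewrite truncn_gt0.
have /card_geqP[sA [uA sizeA _]] : (N <= #|[set: 'rV['F_p]_(q + k)]|)%N.
  rewrite cardsT card_mx mul1n card_Fp // -(ler_nat R) -powN.
  by rewrite (le_trans Na) // ler_powR // ltW.
exists [set x in sA]; rewrite cardsE (card_uniqP uA) sizeA; split.
  by move: aN; rewrite -natr1; have : 1 <= N%:R :> R; [rewrite ler1n|lra].
have -> : (p ^ (q * k) = #|[set: 'M['F_p]_(q, k)]|)%N by rewrite cardsT card_mx card_Fp.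
apply: exceptional_graphs => B _.
case/orP: as_ks => h; apply: le_lt_trans (ltr_powR P1 h).
  apply: le_trans Na; rewrite ler_nat (leq_trans (leq_imset_card _ _)) //.
  by rewrite cardsE (card_uniqP uA) sizeA.
rewrite powN ler_nat.
have -> : (p ^ k = #|[set: 'rV['F_p]_k]|)%N by rewrite cardsT card_mx mul1n card_Fp.
by apply: card_dual_proj_graph => x _; rewrite inE.
Qed.

(** * The theorem *)

Theorem theorem1p10 (R : realType) (n k : nat) (a s : R)
    (k_ge1 : (1 <= k)%N) (k_lt_n : (k < n)%N)
    (a_gt0 : 0 < a) (a_le_n : a <= n%:R) (s_gt0 : 0 < s) :
  exists (c : R) (p0 : nat), 0 < c /\
    forall p : nat, prime p -> (p0 <= p)%N ->
      exists A : {set 'rV['F_p]_n},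
        c * p%:R `^ a <= #|A|%:R /\
        (c%:E * epowR p%:R (marstrand_index a s n k)
           <= (#|exceptional_set A s k|%:R)%:E)%E.
Proof.
have [q nE] : exists q, n = (q + k)%N by exists (n - k)%N; rewrite subnK // ltnW.
subst n.
have aE : a = (ipart a)%:~R + fpart a by rewrite /fpart addrC subrK.
have sE : s = (ipart s)%:~R + fpart s by rewrite /fpart addrC subrK.
have /andP[fa0 fa1] := fpart_itv a; have /andP[fs0 fs1] := fpart_itv s.
have := ipart_ge0 a_gt0; have := ipart_ge0 s_gt0.
rewrite /marstrand_index.
have lk : s <= Num.min a k%:R -> ipart s < k%:Z.
  rewrite le_min => /andP[_ sk]; rewrite -(ltr_int R).
  by apply: lt_le_trans sk; rewrite [ltRHS]sE ltrDl.
case: ifP => [type1 _ _|_].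
  exists 2^-1, 0%N; split=> [|p p_prime _]; first by rewrite invr_gt0.
  have [A [cA cE]] := trivial_example p_prime a_gt0 a_le_n type1.
  exists A; split=> //; rewrite -EFinM lee_fin.
  have -> : k%:R * ((q + k)%:R - k%:R) = (q * k)%:R :> R.
    by rewrite natrD addrK -natrM mulnC.
  rewrite powR_mulrn // -natrX.
  move: cE; rewrite -(ler_nat R) => cE.
  have := ler0n R (p ^ (q * k)); lra.
case mE : (ipart a) => [m|//]; case lE : (ipart s) => [l|//] _ _.
rewrite mE in aE; rewrite lE in sE lk.
(* Types 2 and 3 differ only in the choice of r and b. *)
have grid (r : nat) (b M : R) : s <= Num.min a k%:R -> (r < q)%N ->
    fpart s <= b <= 1 + fpart s -> a = (r + l)%:R + b ->
    M = k%:R * ((q + k)%:R - k%:R) - r.+1%:R * (k%:R - l%:R)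
        + Num.max (2 * fpart s - b) 0 ->
    exists (c : R) (p0 : nat), 0 < c /\
      forall p : nat, prime p -> (p0 <= p)%N ->
        exists A : {set 'rV['F_p]_(q + k)},
          c * p%:R `^ a <= #|A|%:R /\
          (c%:E * epowR p%:R M%:E <= (#|exceptional_set A s k|%:R)%:E)%E.
  move=> /lk lk' rq bP -> ->.
  have fsP : 0 < fpart s <= 1 by rewrite fs0 fs1.
  have [p0 p0P] := grid_example R q k r l b (fpart s) rq lk' fsP bP.
  exists 9^-1, p0; split=> [|p p_prime p_big]; first by rewrite invr_gt0.
  have [A [cA cE]] := p0P p p_prime p_big; exists A; split=> //.
  rewrite -EFinM lee_fin [X in exceptional_set _ X]sE; apply: le_trans cE.
  suff -> : k%:R * ((q + k)%:R - k%:R) - r.+1%:R * (k%:R - l%:R)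
      = (l * r.+1 + k * (q - r.+1))%:R :> R by [].
  by rewrite !natrD !natrM natrB //; ring.
case: ifP => [/and4P[sm lm ml gb]|_].
  apply: (grid (m - l.+1)%N (fpart a + 1)) => //; rewrite ?mE ?lE in lm ml *.
  - lia.
  - lra.
  - have -> : (m - l.+1 + l = m.-1)%N by lia.
    have mS : m%:R = m.-1%:R + 1 :> R by rewrite natr1 prednK //; lia.
    by move: aE; rewrite -pmulrn mS; lra.
  - have -> : (m - l.+1).+1 = (m - l)%N by lia.
    have lm' : (l <= m)%N by lia.
    by rewrite natrB // -!pmulrn; congr (_ - _ * _ + _); ring.
case: ifP => [/and4P[sm lm ml gb]|_].
  apply: (grid (m - l)%N (fpart a)) => //; rewrite ?mE ?lE in lm ml *.
  - lia.
  - lra.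
  - by rewrite subnK //; lia.
  - have lm' : (l <= m)%N by lia.
    by rewrite -[(m - l).+1%:R]natr1 natrB // -!pmulrn; congr (_ - _ * _ + _); ring.
(* The index is -oo, so the bound on exceptional subspaces is void. *)
exists 1, 0%N; split=> // p p_prime _; exists [set: 'rV_(q + k)]; split.
  rewrite mul1r cardsT card_mx mul1n card_Fp // natrX -powR_mulrn //.
  by rewrite ler_powR // ler1n prime_gt0.
by rewrite mule0 lee_fin.
Qed.
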